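(* For each prime $p$, there exists a rank-$1$ torsion-free MCD monoid $M$ that is atomic but whose monoid algebra $\mathbb{F}_p[M]$ is not atomic.
   Context: A monoid means a cancellative commutative semigroup with identity. It is torsion-free if $nb=nc$ (additive notation) with $n\ge 1$ implies $b=c$. The rank of $M$ is $\dim_{\mathbb{Q}} (\mathbb{Q}\otimes_{\mathbb{Z}} \mathcal{G}(M))$, where $\mathcal{G}(M)$ is the Grothendieck (difference) group of $M$; a torsion-free monoid has rank $1$ iff it is isomorphic to a nontrivial additive submonoid of $\mathbb{Q}$. Divisibility: $b\mid_M a$ if $a=b+c$ for some $c\in M$. For a nonempty finite subset $S$ of $M$, a common divisor $d\in M$ of $S$ is a maximal common divisor (MCD) of $S$ if the only common divisors of $\{s-d : s\in S\}$ in $M$ are the units (invertible elements) of $M$. $M$ is an MCD monoid if every nonempty finite subset of $M$ has an MCD. An atom of a monoid is a nonunit that is not the product (sum, in additive notation) of two nonunits; a monoid is atomic if every nonunit is a finite product (sum) of atoms. An integral domain is atomic if its multiplicative monoid of nonzero elements is atomic. $\mathbb{F}_p[M]$ is the monoid algebra of $M$ over the field $\mathbb{F}_p$ with $p$ elements: polynomial expressions in $x$ with exponents in $M$ and coefficients in $\mathbb{F}_p$; it is an integral domain. *)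

(* Defs.v *)
From HB Require Import structures.
From mathcomp Require Import all_boot all_order all_algebra finmap generic_quotient.
From mathcomp Require Import ssrAC ring_quotient boolp.
From mathcomp.multinomials Require Import monalg.

Set Implicit Arguments.
Unset Strict Implicit.
Unset Printing Implicit Defensive.

Import GRing.Theory.
Local Open Scope ring_scope.
Local Open Scope quotient_scope.

(* Factorization in the commutative monoid (D, op, e) carried by a subset D of
   T. It is used below with D = M for an additive monoid M and with D = R \ {0}
   for the multiplicative monoid of an integral domain R. *)
Section Factorization.
Variables (T : eqType) (op : T -> T -> T) (e : T) (D : {pred T}).

Definition is_unit (u : T) : Prop :=
  u \in D /\ exists2 v, v \in D & op u v = e.

Definition is_atom (a : T) : Prop :=
  [/\ a \in D, ~ is_unit a
    & forall b c, b \in D -> c \in D -> a = op b c -> is_unit b \/ is_unit c].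

Definition is_atomic : Prop :=
  forall a, a \in D -> ~ is_unit a ->
  exists2 s : seq T, (forall b, b \in s -> is_atom b) & a = foldr op e s.

End Factorization.

Section AdditiveMonoids.
Variable M : nmodType.
Implicit Types (a b c d s : M) (S : M -> Prop).

Definition cancellative : Prop := forall a b c, a + b = a + c -> b = c.

Definition torsion_free : Prop :=
  forall (n : nat) b c, (0 < n)%N -> b *+ n = c *+ n -> b = c.

Definition monoid_unit : M -> Prop := is_unit (@GRing.add M) 0 predT.

Definition atomic_monoid : Prop := is_atomic (@GRing.add M) 0 predT.

Definition mdivides b a : Prop := exists c, a = b + c.

Definition common_divisor S d : Prop := forall s, S s -> mdivides d s.

(* As M is cancellative, c = s - d is the unique solution of s = d + c. *)
Definition shift_set S d : M -> Prop := fun c => exists2 s, S s & s = d + c.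

Definition is_MCD S d : Prop :=
  common_divisor S d /\
  forall c, common_divisor (shift_set S d) c -> monoid_unit c.

Definition MCD_monoid : Prop :=
  forall S : {fset M}, S != fset0 -> exists d, is_MCD (fun s => s \in S) d.

End AdditiveMonoids.

(* The Grothendieck group: formal differences a - b, represented by pairs. The
   extra summand k makes this an equivalence relation for every M; it can be
   dropped when M is cancellative. *)
Section Grothendieck.
Variable M : nmodType.
Implicit Types x y z : M * M.

Definition groth_eqv x y : bool :=
  `[< exists k, x.1 + y.2 + k = y.1 + x.2 + k >].

Lemma groth_eqvP x y :
  reflect (exists k, x.1 + y.2 + k = y.1 + x.2 + k) (groth_eqv x y).
Proof. exact: asboolP. Qed.

Lemma groth_eqv_equiv : equiv_class_of groth_eqv.
Proof.
split=> [x|x y|y x z]; first by apply/groth_eqvP; exists 0.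
  by apply/groth_eqvP/groth_eqvP => -[k xy]; exists k; rewrite xy.
move=> /groth_eqvP[k xy] /groth_eqvP[l yz]; apply/groth_eqvP.
exists (k + l + (y.1 + y.2)).
transitivity ((x.1 + y.2 + k) + (y.1 + z.2 + l)).
  by rewrite (AC (2*(2*2)) ((1*6*3)*(5*2*4))).
rewrite xy yz.
by rewrite (AC (3*3) ((4*2)*((3*6)*(1*5)))).
Qed.

Canonical groth_eqv_equivrel := EquivRelPack groth_eqv_equiv.
Canonical groth_eqv_enc := defaultEncModRel groth_eqv.

Definition grothendieck := {eq_quot groth_eqv}.

HB.instance Definition _ : EqQuotient _ groth_eqv grothendieck :=
  EqQuotient.on grothendieck.
HB.instance Definition _ := Choice.on grothendieck.

Definition gdiff (a b : M) : grothendieck := \pi_grothendieck (a, b).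

Lemma gdiffP a b c d :
  gdiff a b = gdiff c d <-> exists k, a + d + k = c + b + k.
Proof.
rewrite /gdiff; split=> [/eqmodP/groth_eqvP //|h].
by apply/eqmodP/groth_eqvP.
Qed.

Lemma gdiffE (x : grothendieck) : gdiff (repr x).1 (repr x).2 = x.
Proof. by rewrite /gdiff -surjective_pairing reprK. Qed.

Definition gadd (x y : grothendieck) : grothendieck :=
  gdiff ((repr x).1 + (repr y).1) ((repr x).2 + (repr y).2).
Definition gopp (x : grothendieck) : grothendieck := gdiff (repr x).2 (repr x).1.

Lemma gaddE a b c d : gadd (gdiff a b) (gdiff c d) = gdiff (a + c) (b + d).
Proof.
rewrite /gadd.
have /gdiffP[k] := gdiffE (gdiff a b); have /gdiffP[l] := gdiffE (gdiff c d).
case: (repr (gdiff a b)) (repr (gdiff c d)) => [a' b'] [c' d'] /= hl hk.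
apply/gdiffP; exists (k + l).
transitivity ((a' + b + k) + (c' + d + l)).
  by rewrite (AC ((2*2)*2) ((1*3*5)*(2*4*6))).
by rewrite hk hl (AC (3*3) (((1*4)*(2*5))*(3*6))).
Qed.

Lemma goppE a b : gopp (gdiff a b) = gdiff b a.
Proof.
rewrite /gopp; have /gdiffP[k hk] := gdiffE (gdiff a b).
apply/gdiffP; exists k.
by rewrite [_ + a]addrC -hk [_ + b]addrC.
Qed.

Lemma gaddA : associative gadd.
Proof.
by move=> x y z; rewrite -[x]gdiffE -[y]gdiffE -[z]gdiffE !gaddE !addrA.
Qed.

Lemma gaddC : commutative gadd.
Proof.
move=> x y; rewrite -[x]gdiffE -[y]gdiffE !gaddE.
by congr gdiff; rewrite addrC.
Qed.

Lemma gadd0 : left_id (gdiff 0 0) gadd.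
Proof. by move=> x; rewrite -[x]gdiffE gaddE !add0r. Qed.

Lemma gaddN : left_inverse (gdiff 0 0) gopp gadd.
Proof.
move=> x; rewrite -[x]gdiffE goppE gaddE; apply/gdiffP; exists 0.
by rewrite !addr0 add0r addrC.
Qed.

HB.instance Definition _ :=
  GRing.isZmodule.Build grothendieck gaddA gaddC gadd0 gaddN.

Lemma gdiffD a b c d : gdiff a b + gdiff c d = gdiff (a + c) (b + d).
Proof. exact: gaddE. Qed.

Lemma gdiffN a b : - gdiff a b = gdiff b a.
Proof. exact: goppE. Qed.

End Grothendieck.

(* The tensor product of rat and G over the integers, with its rational vector
   space structure: the quotient of the free rational vector space on G by the
   relations [g + h] = [g] + [h], where q (x) g is the class of q [g]. That it
   is the tensor product is lemma tens_univ. *)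
Section Tensor.
Variable G : zmodType.
Implicit Types (q r : rat) (g h : G) (x y : {malg rat[G]}).

Inductive tens_rel : {malg rat[G]} -> Prop :=
| tens_rel_gen g h : tens_rel (<< g + h >> - << g >> - << h >>)
| tens_rel0 : tens_rel 0
| tens_rel_lin q x y : tens_rel x -> tens_rel y -> tens_rel (q *: x + y).

Definition tens_null : {pred {malg rat[G]}} := fun x => `[< tens_rel x >].

Lemma tens_nullP x : reflect (tens_rel x) (x \in tens_null).
Proof. exact: asboolP. Qed.

Lemma tens_null_submod : submod_closed tens_null.
Proof.
split; first exact/tens_nullP/tens_rel0.
by move=> q x y /tens_nullP hx /tens_nullP hy; apply/tens_nullP/tens_rel_lin.
Qed.

HB.instance Definition _ :=
  GRing.isSubmodClosed.Build rat {malg rat[G]} tens_null tens_null_submod.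

Definition ratTensor : Type := Quotient.quot tens_null.

HB.instance Definition _ := GRing.Zmodule.on ratTensor.

Definition tens q g : ratTensor := \pi_(Quotient.quot tens_null) << q *g g >>.

Let pi x : ratTensor := \pi_(Quotient.quot tens_null) x.

Let piP x y : pi x = pi y <-> x - y \in tens_null.
Proof. by rewrite Quotient.idealrBE; split=> [h|/eqP h]; first exact/eqP. Qed.

Let piD x y : pi (x + y) = pi x + pi y.
Proof. by rewrite /pi !piE. Qed.

Let piS (t : ratTensor) : exists x, t = pi x.
Proof. by exists (repr t); rewrite /pi reprK. Qed.

Definition tens_scale q (t : ratTensor) : ratTensor :=
  \pi_(Quotient.quot tens_null) (q *: repr t).

Let scale_pi q x : tens_scale q (pi x) = pi (q *: x).
Proof.
apply/piP; rewrite -scalerBr; apply: rpredZ.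
by apply/piP; rewrite /pi reprK.
Qed.

Lemma tens_scaleA q r t : tens_scale q (tens_scale r t) = tens_scale (q * r) t.
Proof. by have [x ->] := piS t; rewrite !scale_pi scalerA. Qed.

Lemma tens_scale1 : left_id 1 tens_scale.
Proof. by move=> t; have [x ->] := piS t; rewrite scale_pi scale1r. Qed.

Lemma tens_scaleDr : right_distributive tens_scale +%R.
Proof.
move=> q t u; have [x ->] := piS t; have [y ->] := piS u.
by rewrite -piD !scale_pi scalerDr piD.
Qed.

Lemma tens_scaleDl t : {morph tens_scale^~ t : q r / q + r}.
Proof.
by move=> q r; have [x ->] := piS t; rewrite !scale_pi scalerDl piD.
Qed.

HB.instance Definition _ := GRing.Zmodule_isLmodule.Build rat ratTensor
  tens_scaleA tens_scale1 tens_scaleDr tens_scaleDl.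

Lemma tensZ q r g : q *: tens r g = tens (q * r) g.
Proof.
rewrite [LHS]scale_pi; congr (\pi_(_) _).
by apply/malgP=> k; rewrite mcoeffZ !mcoeffU mulrnAr.
Qed.

Lemma tensDl q r g : tens (q + r) g = tens q g + tens r g.
Proof. by rewrite /tens monalgUD [LHS]piD. Qed.

Lemma tensDr q g h : tens q (g + h) = tens q g + tens q h.
Proof.
suff E : tens 1 (g + h) = tens 1 g + tens 1 h.
  by rewrite -[q]mulr1 -!tensZ E scalerDr.
rewrite /tens -[RHS]piD; apply/piP; rewrite opprD addrA.
exact/tens_nullP/tens_rel_gen.
Qed.

Lemma tens_univ (A : zmodType) (f : rat -> G -> A) :
    (forall q r g, f (q + r) g = f q g + f r g) ->
    (forall q g h, f q (g + h) = f q g + f q h) ->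
  exists! u : ratTensor -> A,
    (forall s t, u (s + t) = u s + u t) /\ (forall q g, u (tens q g) = f q g).
Proof.
move=> fDl fDr.
have f0 g : f 0 g = 0 by apply: (addrI (f 0 g)); rewrite -fDl !addr0.
pose F x := \sum_(g <- msupp x) f x@_g g.
have FE (d : {fset G}) x :
    (msupp x `<=` d)%fset -> F x = \sum_(g <- d) f x@_g g.
  by move=> le; apply: big_fset_incl => // g _ /mcoeff_outdom ->; rewrite f0.
have FD x y : F (x + y) = F x + F y.
  have lex := fsubsetUl (msupp x) (msupp y).
  have ley := fsubsetUr (msupp x) (msupp y).
  rewrite (FE _ _ (msuppD_le x y)) (FE _ _ lex) (FE _ _ ley) -big_split /=.
  by apply: eq_bigr => g _; rewrite mcoeffD fDl.
have F0 : F 0 = 0 by rewrite /F msupp0 big_seq_fset0.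
have FN x : F (- x) = - F x by apply: (addrI (F x)); rewrite -FD !subrr.
have FU q g : F << q *g g >> = f q g.
  by rewrite (FE _ _ msuppU_le) big_seq_fset1 mcoeffUU.
have ZU q g : q *: (<< g >> : {malg rat[G]}) = << q *g g >>.
  by apply/malgP=> k; rewrite mcoeffZ !mcoeffU mulrnAr mulr1.
have Fnull x : tens_rel x -> forall q, F (q *: x) = 0.
  elim=> [g h||r y z _ IHy _ IHz] q.
  - rewrite !scalerBr !ZU !FD !FN !FU fDr.
    by rewrite [f q g + _]addrC addrK subrr.
  - by rewrite scaler0 F0.
  - by rewrite scalerDr scalerA FD IHy IHz addr0.
have FP x y : pi x = pi y -> F x = F y.
  move=> /piP/tens_nullP/Fnull/(_ 1); rewrite scale1r FD FN.
  by move/eqP; rewrite subr_eq0 => /eqP.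
have Frepr x : F (repr (pi x)) = F x by apply: FP; rewrite /pi reprK.
exists (fun t => F (repr t)); split; first split.
- move=> s t; have [x ->] := piS s; have [y ->] := piS t.
  by rewrite -piD !Frepr FD.
- by move=> q g; rewrite Frepr FU.
move=> u [uD uf]; apply/funext => t; have [x ->] := piS t; rewrite Frepr.
have u0 : u 0 = 0 by apply: (addrI (u 0)); rewrite -uD !addr0.
have pi0 : pi 0 = 0 by apply: (addrI (pi 0)); rewrite -piD !addr0.
have piU q g : pi << q *g g >> = tens q g by [].
rewrite [in RHS](monalgE x) (big_morph _ piD pi0).
rewrite (big_morph _ uD u0).
by apply: eq_bigr => g _; rewrite piU uf.
Qed.

End Tensor.

Definition has_rank (M : nmodType) (n : nat) : Prop :=
  inhabited (Vector.axiom n (ratTensor (grothendieck M))).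

(* The library makes {malg R[K]} a ring only when 1 is the sole unit of the
   monoid K, so the convolution product is set up here for an arbitrary
   commutative monoid M, on the same finitely supported functions. *)
Section MonoidAlgebra.
Variables (R : comNzRingType) (M : nmodType).

Definition monoid_algebra : Type := {malg R[M]}.

HB.instance Definition _ := GRing.Zmodule.on monoid_algebra.

Implicit Types f g h : monoid_algebra.

Definition ma_one : monoid_algebra := << 1 *g 0 >>.

Definition ma_mul f g : monoid_algebra :=
  \sum_(a <- msupp f) \sum_(b <- msupp g) << f@_a * g@_b *g a + b >>.

Lemma ma_mulw (d e : {fset M}) f g :
    (msupp f `<=` d)%fset -> (msupp g `<=` e)%fset ->
  ma_mul f g = \sum_(a <- d) \sum_(b <- e) << f@_a * g@_b *g a + b >>.
Proof.
move=> le_d le_e; rewrite /ma_mul (big_fset_incl _ le_d) /=; last first.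
  move=> a _ /mcoeff_outdom fa.
  by rewrite big1 // => b _; rewrite fa mul0r monalgU0.
apply: eq_bigr => a _; apply: big_fset_incl => // b _ /mcoeff_outdom ->.
by rewrite mulr0 monalgU0.
Qed.

Lemma ma_mulUU c d a b :
  ma_mul << c *g a >> << d *g b >> = << c * d *g a + b >>.
Proof. by rewrite (ma_mulw msuppU_le msuppU_le) !big_seq_fset1 !mcoeffUU. Qed.

Lemma ma_mulC : commutative ma_mul.
Proof.
move=> f g; rewrite /ma_mul exchange_big /=.
apply: eq_bigr => b _; apply: eq_bigr => a _.
by rewrite mulrC [a + b]addrC.
Qed.

Lemma ma_mulDl : left_distributive ma_mul +%R.
Proof.
move=> f g h; have lef := fsubsetUl (msupp f) (msupp g).
have leg := fsubsetUr (msupp f) (msupp g).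
have leh := fsubset_refl (msupp h).
rewrite (ma_mulw (msuppD_le f g) leh) (ma_mulw lef leh) (ma_mulw leg leh).
rewrite -big_split /=; apply: eq_bigr => a _.
rewrite -big_split /=; apply: eq_bigr => b _.
by rewrite mcoeffD mulrDl monalgUD.
Qed.

Lemma ma_mulDr : right_distributive ma_mul +%R.
Proof. by move=> f g h; rewrite ma_mulC ma_mulDl ![ma_mul _ f]ma_mulC. Qed.

Lemma ma_mul0l f : ma_mul 0 f = 0.
Proof. by rewrite /ma_mul msupp0 big_seq_fset0. Qed.

Lemma ma_mul0r f : ma_mul f 0 = 0.
Proof. by rewrite ma_mulC ma_mul0l. Qed.

Lemma ma_ind (P : monoid_algebra -> Prop) :
    P 0 -> (forall f g, P f -> P g -> P (f + g)) ->
    (forall c a, P << c *g a >>) ->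
  forall f, P f.
Proof. by move=> P0 PD PU f; rewrite [f]monalgE; apply: big_ind. Qed.

Lemma ma_mulA : associative ma_mul.
Proof.
move=> f g h; elim/ma_ind: f => [|f f' IHf IHf'|c a].
- by rewrite !ma_mul0l.
- by rewrite !ma_mulDl IHf IHf'.
elim/ma_ind: g => [|g g' IHg IHg'|d b].
- by rewrite ma_mul0r !ma_mul0l ma_mul0r.
- by rewrite ma_mulDl !ma_mulDr ma_mulDl IHg IHg'.
elim/ma_ind: h => [|h h' IHh IHh'|e k].
- by rewrite !ma_mul0r.
- by rewrite !ma_mulDr IHh IHh'.
by rewrite !ma_mulUU mulrA addrA.
Qed.

Lemma ma_mul1l : left_id ma_one ma_mul.
Proof.
elim/ma_ind => [|f g IHf IHg|c a]; first by rewrite ma_mul0r.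
  by rewrite ma_mulDr IHf IHg.
by rewrite ma_mulUU mul1r add0r.
Qed.

Lemma ma_one_neq0 : ma_one != 0.
Proof. by rewrite monalgU_eq0 oner_eq0. Qed.

HB.instance Definition _ := GRing.Zmodule_isComNzRing.Build monoid_algebra
  ma_mulA ma_mulC ma_mul1l ma_mulDl ma_one_neq0.

End MonoidAlgebra.

(* Meant for integral domains R, whose nonzero elements form a monoid. *)
Definition atomic_domain (R : comNzRingType) : Prop :=
  is_atomic (@GRing.mul R) 1 (predC1 0).

(* Main.v *)
(** Let d_n = 2k_n + 1 be pairwise coprime, coprime to p, with k_n >= 3p^n, and
    let M be the additive monoid generated by a_n = k_n/(p^n d_n) and
    b_n = (k_n + 1)/(p^n d_n). Since a_n + b_n = p^-n, M contains N[1/p], and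
    modulo Z[1/p] the element b_n is the inverse of a_n, which has order d_n. So
    every s in M is uniquely u + sum_n c_n(w_n) with u in N[1/p], |w_n| <= k_n,
    and c_n(w) = w a_n or |w| b_n according to the sign of w. Adding two elements
    can only produce nonnegative carries into u, so an element with u = 0 has
    finitely many divisors: the a_n and b_n are atoms, and M is an MCD monoid.

    In F_p[M], let g divide 1 + x. Exponents of g lie in [0, 1], where the digits
    w_n are too small to carry and so are additive; comparing leading terms for
    an order refining w_n or -w_n gives w_n = 0 on the support of g. Hence g lies
    in F_p[N[1/p]], where every element is a p-th power, and g is no atom. *)
From HB Require Import structures.
Require Import Defs.
From mathcomp Require Import all_boot all_order all_algebra finmap.
From mathcomp Require Import boolp monalg.
From mathcomp Require Import zify ring lra.

Set Implicit Arguments.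
Unset Strict Implicit.
Unset Printing Implicit Defensive.

Import Order.TTheory GRing.Theory Num.Theory.
Local Open Scope ring_scope.

(** * Pairwise coprime denominators *)

Section Denominators.
Variable p : nat.

(* [den n] is the Fermat-type number (2p)^(2^(n+3)) + 1; these are pairwise
   coprime, and coprime to p. *)
Definition half (n : nat) : nat := ((2 * p) ^ (2 ^ n.+3))./2.

Definition den (n : nat) : nat := (half n).*2.+1.

Lemma denE n : den n = ((2 * p) ^ (2 ^ n.+3)).+1.
Proof.
rewrite /den /half halfK oddX oddM /=.
by rewrite expn_eq0 /= subn0.
Qed.

(** For [p > 0] and [m < n], repeated difference of squares shows that [den m] divides [den n - 2].
    A common divisor thus divides 2, and [den m] is odd. *)
Lemma coprime_den m n : m != n -> coprime (den m) (den n).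
Proof.
wlog lt_mn : m n / (m < n)%N => [hw|_].
  by rewrite neq_ltn => /orP[] h; [|rewrite coprime_sym];
     apply: hw; rewrite ?ltn_eqF.
have dvd : (den m %| (2 * p) ^ (2 ^ n.+3) - 1)%N.
  have: (m.+4 <= n.+3)%N by [].
  elim: (n.+3) => // j IHj; rewrite leq_eqVlt => /predU1P[[<-]|/IHj dvd].
    rewrite [in X in (_ %| X)%N]expnSr expnM -[X in (_ - X)%N](exp1n 2) subn_sqr.
    by rewrite addn1 -denE dvdn_mull.
  rewrite expnSr expnM -[X in (_ - X)%N](exp1n 2) subn_sqr.
  exact: dvdn_mulr.
have [p0|p_gt0] := posnP p.
  by rewrite !denE p0 muln0 !exp0n ?expn_gt0.
have den2 : den n = ((2 * p) ^ (2 ^ n.+3) - 1 + 2)%N.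
  by rewrite denE addnS addn1 subn1 prednK // expn_gt0 muln_gt0 p_gt0.
have /dvdnP[q q_eq] := dvd.
by rewrite /coprime den2 q_eq gcdnMDl -/(coprime _ _) coprimen2 /= odd_double.
Qed.

Lemma coprime_p_den n : coprime p (den n).
Proof.
have dvd : (p %| (2 * p) ^ (2 ^ n.+3))%N.
  have ->: (2 ^ n.+3 = (2 ^ n.+3).-1.+1)%N by rewrite prednK ?expn_gt0.
  by rewrite expnS dvdn_mulr ?dvdn_mull.
by rewrite denE; have /dvdnP[q ->] := dvd; rewrite /coprime -addn1 gcdnMDl gcdn1.
Qed.

(** The factor 3 is what excludes carries between summands of an element of value at most 1, in
    [digitD]. *)
Lemma half_ge n : (0 < p)%N -> (3 * p ^ n <= half n)%N.
Proof.
move=> p_gt0.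
have le1 : (n.+3 <= 2 ^ n.+3)%N by rewrite ltnW // ltn_expl.
have le2 : ((2 * p) ^ n.+3 <= (2 * p) ^ (2 ^ n.+3))%N.
  by rewrite leq_pexp2l // muln_gt0.
have le3 : (8 * p ^ n <= (2 * p) ^ n.+3)%N.
  rewrite expnMn leq_mul //; first by rewrite (@leq_pexp2l 2 3).
  by rewrite leq_pexp2l //; lia.
rewrite /half geq_half_double; lia.
Qed.
End Denominators.

(** * Carries of balanced residues modulo 2k+1 *)

(* The cost of the residue w modulo 2k+1, as a multiple of 1/(2k+1), when 1 is
   paid by a generator k/(2k+1) and -1 by a generator (k+1)/(2k+1). *)
Definition weight (k : nat) (w : int) : int :=
  if 0 <= w then w * k%:Z else - w * k.+1%:Z.

(** The third clause gives additivity of small digits; the last two control divisors and atoms. The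
    bound [1 < k] excludes [k = 1], where [1 + 1 = -1] modulo 3 at equal cost, without carry. *)
Variant carry_spec (k : nat) (x y z : int) (c : nat) : Prop :=
  CarrySpec of `|z| <= k%:Z
  & weight k x + weight k y = weight k z + c%:Z * k.*2.+1%:Z
  & (`|x| + `|y| <= k%:Z -> z = x + y)
  & (c = 0%N -> z = 0 -> x = 0 /\ y = 0)
  & (c = 0%N -> `|z| = 1 -> (1 < k)%N -> x = 0 \/ y = 0).

Lemma carryP (k : nat) (x y : int) : `|x| <= k%:Z -> `|y| <= k%:Z ->
  exists z c, carry_spec k x y z c.
Proof.
move=> hx hy; rewrite /weight.
have [sgt|sle] := ltP k%:Z (x + y).
  (* Residue 1 taken [k + 1] times and residue -1 taken [k] times both cost [k * (k + 1)], so the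
     carry starts at 0 when [x + y = k + 1]. *)
  exists (x + y - k.*2.+1%:Z)%R; exists (absz (x + y - k.+1%:Z)%R).
  split; rewrite /weight; try (move: hx hy sgt; lia).
  do 3?case: ifP; try (move: hx hy sgt; nia).
have [slt|sge] := ltP (x + y) (- k%:Z).
  exists (x + y + k.*2.+1%:Z)%R; exists (absz (- x - y - k%:Z)%R).
  split; rewrite /weight; try (move: hx hy slt; lia).
  do 3?case: ifP; try (move: hx hy slt; nia).
have [x0|x0] := leP 0 x; have [y0|y0] := leP 0 y.
- exists (x + y)%R; exists (0%N);
  split; rewrite /weight; try lia; do 3?case: ifP; nia.
(* Each cancelled pair of residues 1 and -1 costs [k + (k + 1)], one unit of carry. *)
- exists (x + y)%R; exists (absz (Num.min x (- y))%R);
  split; rewrite /weight; try lia; do 3?case: ifP; nia.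
- exists (x + y)%R; exists (absz (Num.min (- x) y)%R);
  split; rewrite /weight; try lia; do 3?case: ifP; nia.
- exists (x + y)%R; exists (0%N);
  split; rewrite /weight; try lia; do 3?case: ifP; nia.
Qed.

Lemma weight_ge0 k w : 0 <= weight k w.
Proof. by rewrite /weight; case: ifP; nia. Qed.

Lemma weight0 k : weight k 0 = 0.
Proof. by rewrite /weight lexx mul0r. Qed.

Lemma weight_ge k w : `|w| * k%:Z <= weight k w.
Proof. by rewrite /weight; case: ifP; nia. Qed.

(** Modulo 2k+1 the weight is [k * w] with [k] invertible, and [w - w'] is smaller than 2k+1 in
    absolute value. *)
Lemma weight_inj_mod k w w' : `|w| <= k%:Z -> `|w'| <= k%:Z ->
  (k.*2.+1%:Z %| weight k w - weight k w')%Z -> w = w'.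
Proof.
move=> hw hw' dvd.
have /dvdzP[q q_eq] : (k.*2.+1%:Z %| (w - w'))%Z.
  have cop : coprimez k.*2.+1%:Z k%:Z.
    rewrite /coprimez /gcdz /= -addn1 -mul2n gcdnC gcdnMDl ?gcdn1 //.
  have wE x : exists z, weight k x = k%:Z * x + k.*2.+1%:Z * z.
    rewrite /weight; case: ifP => _; [exists 0|exists (- x)]; first by ring.
    by rewrite -addn1 -mul2n; nia.
  rewrite -(Gauss_dvdzr _ cop).
  have [[z hz] [z' hz']] := (wE w, wE w'); have /dvdzP[q hq] := dvd.
  by apply/dvdzP; exists (q - z + z'); rewrite mulrBr; nia.
have [q1|[q1|q1]] : 1 <= q \/ q <= -1 \/ q = 0 by lia.
- by nia.
- by nia.
- by move: q_eq; rewrite q1; lia.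
Qed.

(** * Expansions in digits and their addition *)

Section Representation.
Variable p : nat.

Definition cost (n : nat) (w : int) : rat :=
  (weight (half p n) w)%:~R / ((p ^ n)%:R * (den p n)%:R).

(** For [p] prime this is N[1/p]. *)
Definition padic (u : rat) : Prop :=
  0 <= u /\ exists j m : nat, u * (p ^ j)%:R = m%:R.

Definition is_rep (s u : rat) (w : nat -> int) (N : nat) : Prop :=
  [/\ padic u, forall n, `|w n| <= (half p n)%:Z,
      forall n, (N <= n)%N -> w n = 0 & s = u + \sum_(n < N) cost n (w n)].

Lemma padic0 : padic 0.
Proof. by split=> //; exists 0%N, 0%N; rewrite mul0r. Qed.

Lemma padicD u v : padic u -> padic v -> padic (u + v).
Proof.
move=> [u0 [i [m hm]]] [v0 [j [l hl]]]; split; first exact: addr_ge0.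
exists (i + j)%N, (m * p ^ j + l * p ^ i)%N.
by rewrite expnD natrD !natrM -hm -hl; ring.
Qed.

Lemma padic_frac c n : padic (c%:R / (p ^ n)%:R).
Proof.
split; first exact: divr_ge0.
have [p0|p0] := eqVneq ((p ^ n)%:R : rat) 0.
  by exists 0%N, 0%N; rewrite p0 invr0 mulr0 mul0r.
by exists n, c; rewrite divfK.
Qed.

Lemma padic_sum (I : Type) (r : seq I) (F : I -> rat) :
  (forall i, padic (F i)) -> padic (\sum_(i <- r) F i).
Proof.
by move=> h; elim/big_rec: _ => [|i u _ hu]; [exact: padic0|exact: padicD].
Qed.

Lemma padicB u v : padic u -> padic v -> v <= u -> padic (u - v).
Proof.
move=> [u0 [i [m hm]]] [v0 [j [l hl]]] le_vu; split; first by rewrite subr_ge0.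
have e : (u - v) * (p ^ (i + j))%:R = (m * p ^ j)%:R - (l * p ^ i)%:R.
  by rewrite expnD !natrM -hm -hl; ring.
exists (i + j)%N, (m * p ^ j - l * p ^ i)%N; rewrite e natrB // -(ler_nat rat).
by rewrite -subr_ge0 -e mulr_ge0 ?subr_ge0.
Qed.

Lemma cost0 n : cost n 0 = 0.
Proof. by rewrite /cost weight0 mul0r. Qed.

Lemma cost_ge0 n w : 0 <= cost n w.
Proof. by rewrite /cost divr_ge0 ?ler0z ?weight_ge0 ?mulr_ge0 ?ler0n. Qed.

Lemma is_rep_widen s u w N N' :
  (N <= N')%N -> is_rep s u w N -> is_rep s u w N'.
Proof.
move=> le_N [hu hw w0 ->]; split=> // [n le_n|]; first exact/w0/(leq_trans le_N).
congr (_ + _); rewrite -!(big_mkord xpredT (fun n => cost n (w n))).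
rewrite (big_cat_nat _ le_N) //= [X in _ = _ + X]big1_seq ?addr0 // => n.
by rewrite mem_index_iota => /andP[_ /andP[/w0-> _]]; rewrite cost0.
Qed.

Lemma is_rep_ge0 s u w N : is_rep s u w N -> 0 <= s.
Proof.
by move=> [[u0 _] _ _ ->]; rewrite addr_ge0 // sumr_ge0 // => n _; exact: cost_ge0.
Qed.

(** A carry [c n] at place [n] is worth [c n / p^n], because the modulus [den p n] cancels. Carries
    can therefore only increase the p-adic part. *)
Lemma is_repD s t u v x y N : is_rep s u x N -> is_rep t v y N ->
  exists (z : nat -> int) (c : nat -> nat),
    is_rep (s + t) (u + v + \sum_(n < N) (c n)%:R / (p ^ n)%:R) z N /\
    forall n, carry_spec (half p n) (x n) (y n) (z n) (c n).
Proof.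
move=> [hu hx x0 ->] [hv hy y0 ->].
have carry n : exists zc, carry_spec (half p n) (x n) (y n) zc.1 zc.2.
  by have [z [c h]] := carryP (hx n) (hy n); exists (z, c).
have [zc hzc] := choice carry.
exists (fun n => (zc n).1), (fun n => (zc n).2); split=> //; split=> //.
- apply: padicD; first exact: padicD.
  by apply: padic_sum => i; exact: padic_frac.
- by move=> n; case: (hzc n).
- move=> n le_n; case: (hzc n) => _ _ + _ _.
  by rewrite x0 // y0 // normr0 addr0; apply.
rewrite addrACA -!addrA; do 2!congr (_ + _); rewrite -!big_split /=.
apply: eq_bigr => n _; case: (hzc n) => _ e _ _ _.
rewrite /cost -mulrDl -intrD e intrD mulrDl addrC; congr (_ + _).
have d0 : (den p n)%:R != 0 :> rat by rewrite pnatr_eq0.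
by rewrite intrM !pmulrn -/(den p n) invfM mulrACA divff // mulr1.
Qed.

End Representation.

(** * Local integrality and uniqueness of the expansion *)

(** For [d > 1] this is Z with all positive integers coprime to [d] inverted. *)
Definition integral_at (d : nat) (q : rat) : Prop :=
  exists N : nat, coprime N d /\ exists z : int, q * N%:R = z%:~R.

Lemma integral_at0 d : integral_at d 0.
Proof. by exists 1%N; split; [exact: coprime1n|exists 0; rewrite mul0r]. Qed.

Lemma integral_atD d q r :
  integral_at d q -> integral_at d r -> integral_at d (q + r).
Proof.
move=> [N [hN [z hz]]] [K [hK [y hy]]]; exists (N * K)%N.
split; first by rewrite coprimeMl hN hK.
by exists (z * K%:Z + y * N%:Z); rewrite intrD !intrM -hz -hy natrM !pmulrn; ring.
Qed.

Lemma integral_atN d q : integral_at d q -> integral_at d (- q).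
Proof.
move=> [N [hN [z hz]]]; exists N; split=> //.
by exists (- z); rewrite mulNr hz intrN.
Qed.

Section Uniqueness.
Variable p : nat.
Hypothesis p_pr : prime p.

Let p_gt0 : (0 < p)%N := prime_gt0 p_pr.

Lemma scale_neq0 n : (p ^ n)%:R * (den p n)%:R != 0 :> rat.
Proof. by rewrite -natrM pnatr_eq0 -lt0n muln_gt0 expn_gt0 p_gt0. Qed.

Lemma padic_integral_at n u : padic p u -> integral_at (den p n) u.
Proof.
move=> [_ [j [m hm]]]; exists (p ^ j)%N; split.
  exact/coprimeXl/coprime_p_den.
by exists m%:Z; rewrite hm.
Qed.

Lemma cost_integral_at m n w : m != n -> integral_at (den p n) (cost p m w).
Proof.
move=> neq; exists (p ^ m * den p m)%N; split.
  by rewrite coprimeMl coprimeXl ?coprime_p_den ?coprime_den.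
by exists (weight (half p m) w); rewrite /cost natrM divfK // scale_neq0.
Qed.

Lemma cost_inj_mod n w w' :
  `|w| <= (half p n)%:Z -> `|w'| <= (half p n)%:Z ->
  integral_at (den p n) (cost p n w - cost p n w') -> w = w'.
Proof.
move=> hw hw' [N [hN [z]]]; rewrite /cost -mulrBl -intrB => e.
apply: (weight_inj_mod hw hw').
have d0 := scale_neq0 n.
move/(congr1 (fun q => q * ((p ^ n)%:R * (den p n)%:R))): e.
rewrite mulrAC divfK // !pmulrn -!intrM => /intr_inj e.
have : ((den p n)%:Z %| N%:Z *
   (weight (half p n) w - weight (half p n) w'))%Z.
  by rewrite mulrC e mulrA dvdz_mull.
by rewrite Gauss_dvdzr // /coprimez /gcdz /= gcdnC.
Qed.

(** Modulo rationals integral at [den p n] only the cost at place [n] survives, so [cost_inj_mod]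
    recovers [w n]; the p-adic part follows by subtraction. *)
Lemma is_rep_uniq s u w N u' w' N' :
  is_rep p s u w N -> is_rep p s u' w' N' -> u = u' /\ w =1 w'.
Proof.
move=> /(is_rep_widen (leq_maxl N N')) [hu hw w0 e].
move=> /(is_rep_widen (leq_maxr N N')) [hu' hw' w0' e'].
set K := maxn N N' in e e' w0 w0' *.
suff ww : w =1 w'.
  split=> //; move: e; rewrite e'.
  rewrite (eq_bigr (fun n : 'I_K => cost p n (w n))) => [/addIr-> //|n _].
  by rewrite ww.
move=> n; have [le_n|lt_n] := leqP K n; first by rewrite w0 ?w0'.
apply: cost_inj_mod (hw n) (hw' n) _.
have -> : cost p n (w n) - cost p n (w' n) = u' - u
     + \sum_(i < K | i != Ordinal lt_n) (cost p i (w' i) - cost p i (w i)).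
  move: e'; rewrite e sumrB (bigD1 (Ordinal lt_n)) //=.
  rewrite [in RHS](bigD1 (Ordinal lt_n)) //= => e0.
  by apply/eqP; rewrite -subr_eq0; apply/eqP; lra.
apply: integral_atD.
  by apply: integral_atD; [|apply: integral_atN]; exact: padic_integral_at.
elim/big_rec: _ => [|i q neq hq]; first exact: integral_at0.
do 2?apply: integral_atD => //; last apply: integral_atN.
  by apply: cost_integral_at; rewrite -(inj_eq val_inj) in neq.
by apply: cost_integral_at; rewrite -(inj_eq val_inj) in neq.
Qed.

End Uniqueness.

(** * The monoid and the digits of its elements *)

Definition pmon_pred (p : nat) : {pred rat} :=
  fun s => `[< exists u w N, is_rep p s u w N >].

Lemma pmon_predP p s :
  reflect (exists u w N, is_rep p s u w N) (s \in pmon_pred p).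
Proof. exact: asboolP. Qed.

Lemma pmon_nmod_closed p : GRing.nmod_closed (pmon_pred p).
Proof.
split=> [|s t /pmon_predP[u [w [N hs]]] /pmon_predP[v [y [K ht]]]].
  apply/pmon_predP; exists 0, (fun=> 0), 0%N; split=> //; first exact: padic0.
  by rewrite big_ord0 addr0.
have hs' := is_rep_widen (leq_maxl N K) hs.
have ht' := is_rep_widen (leq_maxr N K) ht.
have [z [c [h _]]] := is_repD hs' ht'.
by apply/pmon_predP; do 3!eexists; exact: h.
Qed.

Record pmon (p : nat) := PMon {
  pmon_val : rat;
  pmon_valP : pmon_val \in pmon_pred p }.

HB.instance Definition _ p := [isSub for @pmon_val p].
HB.instance Definition _ p := [Choice of pmon p by <:].
HB.instance Definition _ p := GRing.SubChoice_isSubNmodule.Build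
  rat _ (pmon p) (pmon_nmod_closed p).

Section Digits.
Variable p : nat.
Hypothesis p_pr : prime p.
Implicit Types s t b c : pmon p.

Lemma pmon_rep s : exists x : rat * (nat -> int) * nat,
  is_rep p (val s) x.1.1 x.1.2 x.2.
Proof.
by have /pmon_predP[u [w [N h]]] := pmon_valP s; exists (u, w, N).
Qed.

(** By [rep_digit] neither [ipart] nor [digit] depends on the expansion chosen; only [bound]
    does. *)
Definition ipart s : rat := (projT1 (cid (pmon_rep s))).1.1.
Definition digit s : nat -> int := (projT1 (cid (pmon_rep s))).1.2.
Definition bound s : nat := (projT1 (cid (pmon_rep s))).2.

Lemma is_rep_pmon s : is_rep p (val s) (ipart s) (digit s) (bound s).
Proof. exact: projT2 (cid (pmon_rep s)). Qed.

Lemma rep_digit s u w N :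
  is_rep p (val s) u w N -> ipart s = u /\ digit s =1 w.
Proof. exact: (is_rep_uniq p_pr (is_rep_pmon s)). Qed.

Lemma pmon_ofP r u w N : is_rep p r u w N ->
  exists s, [/\ val s = r, ipart s = u & digit s =1 w].
Proof.
move=> h; have hr : r \in pmon_pred p by apply/pmon_predP; exists u, w, N.
have [] := @rep_digit (PMon hr) _ _ _ h.
by exists (PMon hr).
Qed.

Lemma val_pmonD s t : val (s + t) = val s + val t.
Proof. exact: raddfD. Qed.

Lemma val_pmon0 : val (0 : pmon p) = 0.
Proof. exact: raddf0. Qed.

Lemma val_pmonMn s n : val (s *+ n) = val s *+ n.
Proof. exact: raddfMn. Qed.

Lemma val_pmon_sum (I : Type) (r : seq I) (F : I -> pmon p) :
  val (\sum_(i <- r) F i) = \sum_(i <- r) val (F i).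
Proof. exact: raddf_sum. Qed.

Lemma pmon_ge0 s : 0 <= val s.
Proof. exact: is_rep_ge0 (is_rep_pmon s). Qed.

Lemma padic_ipart s : padic p (ipart s).
Proof. by case: (is_rep_pmon s). Qed.

Lemma ipart_ge0 s : 0 <= ipart s.
Proof. by case: (padic_ipart s). Qed.

(** The p-adic part grows by the sum of the nonnegative [c n / p^n], so equality forces every carry
    to vanish. *)
Lemma digit_carry s t : exists c : nat -> nat,
  [/\ ipart s + ipart t <= ipart (s + t),
      ipart (s + t) = ipart s + ipart t -> forall n, c n = 0%N
    & forall n,
      carry_spec (half p n) (digit s n) (digit t n) (digit (s + t) n) (c n)].
Proof.
have hs := is_rep_widen (leq_maxl (bound s) (bound t)) (is_rep_pmon s).
have ht := is_rep_widen (leq_maxr (bound s) (bound t)) (is_rep_pmon t).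
have [z [c [h hc]]] := is_repD hs ht.
rewrite -val_pmonD in h; have [-> dz] := rep_digit h.
have ge0 (n : 'I_(maxn (bound s) (bound t))) :
  xpredT n -> 0 <= (c n)%:R / (p ^ n)%:R :> rat by rewrite divr_ge0.
exists c; split=> [||n]; last by rewrite dz.
  by rewrite lerDl sumr_ge0.
move/eqP; rewrite -subr_eq0 addrC addKr => /eqP/(psumr_eq0P ge0) c0 n.
have [le_n|lt_n] := leqP (maxn (bound s) (bound t)) n.
  (* Places past the bound do not enter that sum; there all digits are 0 and the weight identity
     gives [c n = 0]. *)
  case: hs ht h => _ _ x0 _ [_ _ y0 _] [_ _ z0 _].
  case: (hc n) => _ + _ _ _; rewrite x0 // y0 // z0 // weight0; lia.
have /eqP := c0 (Ordinal lt_n) isT.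
by rewrite mulf_eq0 invr_eq0 !pnatr_eq0 expn_eq0 -(negbK (p == _)%N)
           -lt0n prime_gt0 // orbF => /eqP.
Qed.

Lemma ipart_eq0D s t : ipart (s + t) = 0 ->
  [/\ ipart s = 0, ipart t = 0 & forall n,
     carry_spec (half p n) (digit s n) (digit t n) (digit (s + t) n) 0].
Proof.
move=> st0; have [c [le eq h]] := digit_carry s t.
have s0 := ipart_ge0 s; have t0 := ipart_ge0 t; rewrite st0 in le eq.
have {}s0 : ipart s = 0 by lra.
have {}t0 : ipart t = 0 by lra.
split=> // n; rewrite -(eq _ n) // s0 t0; lra.
Qed.

Lemma cost_digit_le s n : cost p n (digit s n) <= val s.
Proof.
have [_ _ h ->] := is_rep_widen (leq_maxl (bound s) n.+1) (is_rep_pmon s).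
have lt_n : (n < maxn (bound s) n.+1)%N by rewrite leq_max ltnSn orbT.
rewrite (bigD1 (Ordinal lt_n)) //= addrCA lerDl addr_ge0 ?ipart_ge0 //.
by apply: sumr_ge0 => i _; exact: cost_ge0.
Qed.

Lemma half_gt1 n : (1 < half p n)%N.
Proof.
have := half_ge n (prime_gt0 p_pr); apply: leq_trans.
have: (0 < p ^ n)%N by rewrite expn_gt0 prime_gt0.
lia.
Qed.

(** The costs of the two digits sum to at most 1, which keeps the digits too small to wrap
    around. *)
Lemma digitD s t n : val s + val t <= 1 ->
  digit (s + t) n = digit s n + digit t n.
Proof.
move=> le1; have [c [_ _ h]] := digit_carry s t.
case: (h n) => _ _ + _ _; apply.
have : cost p n (digit s n) + cost p n (digit t n) <= 1.
  by apply: le_trans le1; apply: lerD; exact: cost_digit_le.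
rewrite /cost -mulrDl ler_pdivrMr; last first.
  by rewrite lt_neqAle eq_sym scale_neq0 // mulr_ge0.
rewrite mul1r -intrD -natrM pmulrn ler_int.
have := weight_ge (half p n) (digit s n).
have := weight_ge (half p n) (digit t n).
have := half_ge n (prime_gt0 p_pr).
rewrite /den; have := half_gt1 n.
move: (half p n) (p ^ n)%N `|_| `|_| (weight _ _) (weight _ _) => k P x y a b.
move=> k1 leP hx hy hab; rewrite leNgt; apply/negP => lt.
(* If [x + y > k], these bounds give 3(k+1)k <= 3P(2k+1) <= k(2k+1), which is absurd for [k > 0]. *)
have: (3 * (k%:Z + 1) * k%:Z <= 3 * ((x + y) * k%:Z)) by nia.
have: (3 * (P * k.*2.+1)%:Z <= (k * k.*2.+1)%:Z) by nia.
nia.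
Qed.

(** Adding a divisor of [s] to its cofactor produces no carry, so the divisor has digit 0 wherever
    [s] does, and its denominator involves only places below [bound s]. *)
Lemma divisor_denominator s : ipart s = 0 -> exists2 D : nat, (0 < D)%N &
  forall b c, b + c = s -> val b * D%:R \is a Num.nat.
Proof.
move=> s0; pose N := bound s.
exists (\prod_(n < N) (p ^ n * den p n))%N.
  by rewrite prodn_gt0 // => n; rewrite muln_gt0 expn_gt0 prime_gt0.
move=> b c bc; have [hb0 hc0 carry] : [/\ ipart b = 0, ipart c = 0 & forall n,
     carry_spec (half p n) (digit b n) (digit c n) (digit s n) 0].
  by rewrite -bc; apply: ipart_eq0D; rewrite bc.
have [_ _ _ ->] := is_rep_pmon b.
rewrite hb0 add0r mulr_suml; apply: rpred_sum => n _.
have [le_n|lt_n] := leqP N n.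
  case: (carry n) => _ _ _ + _; case: (is_rep_pmon s) => _ _ /(_ n le_n) -> _.
  by move=> /(_ erefl erefl)[-> _]; rewrite cost0 mul0r.
rewrite (bigD1 (Ordinal lt_n)) //= natrM mulrA /cost natrM divfK ?scale_neq0 //.
have /ZnatP[m ->] : weight (half p n) (digit b n) \is a Num.nat.
  by rewrite Znat_def weight_ge0.
by rewrite -natrM.
Qed.

End Digits.

(** * Maximal common divisors and atoms *)

Lemma seq_argmax (T : eqType) (F : T -> rat) (l : seq T) : l != [::] ->
  exists2 x, x \in l & forall y, y \in l -> F y <= F x.
Proof.
elim: l => // x l IHl _; have [->|/IHl[y yl max]] := eqVneq l [::].
  by exists x => [|y]; rewrite inE // => /eqP->.
have [le|lt] := leP (F x) (F y).
  exists y => [|z]; rewrite inE ?yl ?orbT // => /predU1P[->|/max] //.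
exists x => [|z]; rewrite inE ?eqxx // => /predU1P[->|/max le] //.
exact/(le_trans le)/ltW.
Qed.

Section MonoidProperties.
Variable p : nat.
Hypothesis p_pr : prime p.
Local Notation M := (pmon p).
Implicit Types a b c d s t : M.

Lemma pmon_cancellative : cancellative M.
Proof.
move=> a b c /(congr1 val); rewrite !val_pmonD => /addrI e; exact: val_inj.
Qed.

Lemma pmon_torsion_free : torsion_free M.
Proof.
move=> n b c n0 /(congr1 val); rewrite !val_pmonMn => e; apply: val_inj.
apply/eqP; rewrite -subr_eq0; move/eqP: e; rewrite -subr_eq0 -mulrnBl.
by rewrite mulrn_eq0 -[n == _]negbK -lt0n n0.
Qed.

Lemma pmon_val_eq0 s : val s = 0 -> s = 0.
Proof. by move=> s0; apply: val_inj; rewrite s0 val_pmon0. Qed.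

Lemma pmon_unitP s : monoid_unit s <-> s = 0.
Proof.
split=> [[_ [t _ /(congr1 val)]]|->]; last by split=> //; exists 0; rewrite ?addr0.
rewrite val_pmonD val_pmon0 => st; apply: pmon_val_eq0.
have := pmon_ge0 s; have := pmon_ge0 t; lra.
Qed.

Lemma padic_pmon u : padic p u ->
  exists s, [/\ val s = u, ipart s = u & digit s =1 (fun=> 0)].
Proof.
move=> hu; apply: (pmon_ofP p_pr (N := 0)); split=> //.
by rewrite big_ord0 addr0.
Qed.

Lemma pmon_digit0 s :
  ipart s = 0 -> (forall n, digit s n = 0) -> s = 0.
Proof.
move=> s0 d0; apply: pmon_val_eq0; have [_ _ _ ->] := is_rep_pmon s.
by rewrite s0 add0r big1 // => n _; rewrite d0 cost0.
Qed.

Lemma sub_padic s u : padic p u -> u <= ipart s ->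
  exists t, val s = u + val t /\ ipart t = ipart s - u.
Proof.
move=> hu le; have [hs w1 w2 e] := is_rep_pmon s.
have [t [ht1 ht2 _]] : exists t, [/\ val t = val s - u,
    ipart t = ipart s - u & digit t =1 digit s].
  apply: (pmon_ofP p_pr (N := bound s)); split=> //; first exact: padicB.
  by rewrite {1}e addrAC.
by exists t; split; rewrite // ht1 addrC subrK.
Qed.

(* After removing the least p-adic part u occurring in S, some element of S is
   left with p-adic part 0; its divisors have bounded denominators, so there is
   a largest common divisor. *)
Lemma pmon_MCD : MCD_monoid M.
Proof.
move=> S S0.
have [s0 s0S min] : exists2 s0, s0 \in S & forall s, s \in S -> ipart s0 <= ipart s.
  have [|s0 s0S h] := @seq_argmax _ (fun s => - ipart s) S.
    by apply: contraNneq S0 => e; apply/eqP/fsetP => x;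
       rewrite inE -[RHS](in_nil x) -e.
  by exists s0 => // s /h; rewrite lerN2.
have [e0 [e0v _ _]] := padic_pmon (padic_ipart s0).
have [r0 [r0v r00]] := sub_padic (padic_ipart s0) (lexx _).
rewrite subrr in r00.
have s0E : s0 = e0 + r0 by apply: val_inj; rewrite val_pmonD e0v.
have [D D0 hD] := divisor_denominator p_pr r00.
pose cd d := common_divisor (fun s => s \in S) (e0 + d).
have cdD d : cd d -> exists2 c, d + c = r0 & val d * D%:R \is a Num.nat.
  move=> /(_ _ s0S)[c]; rewrite s0E -addrA => /pmon_cancellative e.
  by exists c; rewrite ?e //; apply: (hD d c).
(* The number [val d * D%:R] is natural and at most [val r0 * D%:R], so some candidate [d] maximises
   it. *)
pose P m := `[< exists d, cd d /\ val d * D%:R = m%:R >].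
have exP : exists m, P m.
  exists 0%N; apply/asboolP; exists 0; rewrite val_pmon0 mul0r; split=> // s sS.
  have [t [tv _]] := sub_padic (padic_ipart s0) (min _ sS).
  by exists t; apply: val_inj; rewrite addr0 val_pmonD e0v.
have [K hK] := natrP (hD r0 0 (addr0 _)).
have ubP m : P m -> (m <= K)%N.
  move=> /asboolP[d [/cdD[c cE _] dm]]; rewrite -(ler_nat rat) -dm -hK -cE.
  by rewrite val_pmonD mulrDl lerDl mulr_ge0 ?pmon_ge0.
case: (ex_maxnP exP ubP) => m /asboolP[d [cd_d dm]] max.
exists (e0 + d); split=> // c hc.
(* Since [d + c] is again a candidate, maximality leaves no room for [val c > 0]. *)
have cd_dc : cd (d + c).
  move=> s sS; have [t tE] := cd_d s sS.
  have [t' t'E] : mdivides c t by apply: hc; exists s.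
  by exists t'; rewrite tE t'E !addrA.
have [_ _ /natrP[l hl]] := cdD _ cd_dc.
have le_lm : (l <= m)%N by apply: max; apply/asboolP; exists (d + c).
apply/pmon_unitP/pmon_val_eq0; apply: le_anti; rewrite pmon_ge0 andbT.
have D0' : 0 < D%:R :> rat by rewrite ltr0n.
rewrite -(pmulr_lle0 _ D0').
by move: le_lm; rewrite -(ler_nat rat) -hl -dm val_pmonD mulrDl gerDl.
Qed.

(** With p-adic part 0 no carry occurs, so in a decomposition [b + c] all digits off [n] vanish and
    so does one of the two digits at [n]; that summand is 0. *)
Lemma generator_atom n (e : int) : `|e| = 1 -> exists s,
  val s = cost p n e /\ is_atom (@GRing.add M) 0 predT s.
Proof.
move=> e1; pose w m := if m == n then e else 0.
have h1 := half_gt1 p_pr.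
have [s [sv s0 sd]] : exists s, [/\ val s = cost p n e, ipart s = 0 & digit s =1 w].
  apply: (pmon_ofP p_pr (N := n.+1)); split; first exact: padic0.
  - by move=> m; rewrite /w; case: eqP => _; have := h1 m; lia.
  - by move=> m; rewrite /w; case: eqP => // ->; rewrite ltnn.
  - rewrite add0r big_ord_recr /= /w eqxx big1 ?add0r // => i _.
    by rewrite ltn_eqF // cost0.
exists s; split=> //; split=> // [/pmon_unitP s_eq0|b c _ _ bc].
  have := sd n; rewrite s_eq0 /w eqxx.
  have [] := @rep_digit p p_pr 0 0 (fun=> 0) 0%N.
    by split; rewrite ?val_pmon0 ?big_ord0 ?addr0 //; exact: padic0.
  by move=> _ -> h; rewrite -h in e1.
move: s0; rewrite bc => /ipart_eq0D[//|b0 c0 carry].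
have off m : m != n -> digit b m = 0 /\ digit c m = 0.
  case: (carry m) => _ _ _ + _ mn; apply=> //.
  by rewrite -bc sd /w (negPf mn).
have : digit b n = 0 \/ digit c n = 0.
  case: (carry n) => _ _ _ _; apply=> //.
  by rewrite -bc sd /w eqxx.
case=> h; [left|right]; apply/pmon_unitP/pmon_digit0 => // m.
  by have [->|/off[]] := eqVneq m n.
by have [->|/off[]] := eqVneq m n.
Qed.

Lemma costD n : cost p n 1 + cost p n (-1) = (p ^ n)%:R^-1.
Proof.
have := scale_neq0 p_pr n; rewrite mulf_eq0 => /norP[d0 d1].
rewrite /cost -mulrDl -intrD /weight /=.
have -> : 1 * (half p n)%:Z + - (-1) * (half p n).+1%:Z = (den p n)%:Z.
  by rewrite /den; lia.
change ((den p n)%:R / ((p ^ n)%:R * (den p n)%:R) = (p ^ n)%:R^-1 :> rat).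
by rewrite invfM mulrCA divff ?mulr1.
Qed.

Lemma cost_mulrn n (w : int) :
  cost p n w = cost p n (if 0 <= w then 1 else -1) *+ absz w.
Proof.
have e : weight (half p n) w =
    weight (half p n) (if 0 <= w then 1 else -1) * (absz w)%:Z.
  by rewrite /weight; case: ifP => /=; lia.
by rewrite /cost e intrM mulrAC -[RHS]mulr_natr.
Qed.

Lemma pmon_atomic : atomic_monoid M.
Proof.
pose G s := exists2 l : seq M,
  (forall b, b \in l -> is_atom (@GRing.add M) 0 predT b) &
  s = foldr (@GRing.add M) 0 l.
have G0 : G 0 by exists [::].
have GD s t : G s -> G t -> G (s + t).
  move=> [l hl ->] [k hk ->]; exists (l ++ k) => [b|].
    by rewrite mem_cat => /orP[/hl|/hk].
  by rewrite foldr_cat; elim: l {hl} => [|x l IHl] /=; rewrite ?add0r // -addrA IHl.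
have GMn s n : G s -> G (s *+ n).
  by move=> Gs; elim: n => [|n IHn]; rewrite ?mulr0n // mulrS; apply: GD.
have Gatom s : is_atom (@GRing.add M) 0 predT s -> G s.
  by move=> hs; exists [:: s] => [b|]; rewrite ?inE /= ?addr0 // => /eqP->.
move=> a _ _; change (G a).
have /choice[A hA] n := @generator_atom n 1 erefl.
have /choice[B hB] n := @generator_atom n (-1) erefl.
have [_ [j [m hm]]] := padic_ipart a.
have pj0 : (p ^ j)%:R != 0 :> rat.
  by rewrite pnatr_eq0 -lt0n expn_gt0 prime_gt0.
(* The p-adic part is [m / p^j] and [A j + B j] has value [1 / p^j]; each digit contributes copies
   of one generator. *)
have -> : a = (A j + B j) *+ m + \sum_(n < bound a)
    (if 0 <= digit a n then A n else B n) *+ absz (digit a n).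
  apply: val_inj; have [_ _ _ {1}->] := is_rep_pmon a.
  rewrite val_pmonD val_pmonMn val_pmon_sum val_pmonD.
  have [-> _] := hA j; have [-> _] := hB j; rewrite costD.
  congr (_ + _); first by rewrite -[RHS]mulr_natr -hm mulrCA mulVf ?mulr1.
  apply: eq_bigr => n _; rewrite cost_mulrn val_pmonMn; congr (_ *+ _).
  by case: ifP => _; [case: (hA n)|case: (hB n)].
apply: (GD).
  by apply: (GMn); apply: (GD); apply: (Gatom); [case: (hA j)|case: (hB j)].
elim/big_rec: _ => // n s _ Gs; apply: (GD) => //; apply: GMn; apply: Gatom.
by case: ifP => _; [case: (hA n)|case: (hB n)].
Qed.

End MonoidProperties.

(** * Tensor identities and rank one *)

Section TensorTheory.
Variable G : zmodType.
Implicit Types (q : rat) (x : G).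

Lemma tens0l x : tens 0 x = 0.
Proof. by apply: (addrI (tens 0 x)); rewrite -tensDl !addr0. Qed.

Lemma tens0r q : tens q (0 : G) = 0.
Proof. by apply: (addrI (tens q 0)); rewrite -tensDr !addr0. Qed.

Lemma tensNr q x : tens q (- x) = - tens q x.
Proof. by apply: (addrI (tens q x)); rewrite -tensDr !subrr tens0r. Qed.

Lemma tensBl q r x : tens (q - r) x = tens q x - tens r x.
Proof. by apply: (addIr (tens r x)); rewrite -tensDl !subrK. Qed.

(* The conversion checker diverges on unequal tensors, hence [exact: erefl]
   where the closing [by] would first try the induction hypothesis. *)
Lemma tens_mulrn q x n : tens q (x *+ n) = tens (q * n%:R) x.
Proof.
elim: n => [|n IHn].
  by rewrite (mulr0n x) (mulr0n (1 : rat)) mulr0 tens0r tens0l.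
have -> : q * n.+1%:R = q + q * n%:R by rewrite mulrS mulrDr mulr1.
rewrite (mulrS x) tensDr IHn -tensDl; exact: erefl.
Qed.

End TensorTheory.

Section Rank.
Variable p : nat.
Hypothesis p_pr : prime p.
Local Notation M := (pmon p).
Local Notation G := (grothendieck M).

Lemma padic_nat m : padic p m%:R.
Proof. by have := padic_frac p m 0; rewrite expn0 divr1. Qed.

Lemma exists_pmon1 : exists e : M, val e = 1.
Proof. by have [e []] := padic_pmon p_pr (padic_nat 1); exists e. Qed.

(** This extends [val] to differences; [gval_gdiff] gives independence of the representative. *)
Definition gval (x : G) : rat := val (repr x).1 - val (repr x).2.

Lemma gval_gdiff (a b : M) : gval (gdiff a b) = val a - val b.
Proof.
have /gdiffP[k] := gdiffE (gdiff a b).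
by move=> /(congr1 val); rewrite !val_pmonD /gval; lra.
Qed.

Lemma gvalD (x y : G) : gval (x + y) = gval x + gval y.
Proof.
rewrite -[x]gdiffE -[y]gdiffE gdiffD !gval_gdiff !val_pmonD.
by ring.
Qed.

Lemma gdiff_mulrn (a b : M) n : gdiff a b *+ n = gdiff (a *+ n) (b *+ n).
Proof. by elim: n => [|n IHn] //; rewrite !mulrS IHn gdiffD. Qed.

(** If [val a = m / n], the relation [a *+ n = e *+ m] passes through the tensor product and turns a
    tensor over [a] into one over [e]. *)
Lemma tens_gdiff (e : M) q (x : G) : val e = 1 ->
  tens q x = tens (q * gval x) (gdiff e 0).
Proof.
move=> e1.
have tens_pos a r : tens r (gdiff a 0 : G) = tens (r * val a) (gdiff e 0).
  have a_ge0 := pmon_ge0 a.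
  have n0 : (denq (val a))%:~R != 0 :> rat by rewrite intr_eq0 denq_neq0.
  pose n := absz (denq (val a)); pose m := absz (numq (val a)).
  have nE : (denq (val a))%:~R = n%:R :> rat by rewrite -[denq _]gez0_abs ?ltW.
  have aE : val a = m%:R / n%:R.
    rewrite -nE -[in LHS](divq_num_den (val a)) -[numq _]gez0_abs //.
    by rewrite numq_ge0.
  rewrite nE in n0.
  have e_an : gdiff a 0 *+ n = gdiff e 0 *+ m :> G.
    rewrite !gdiff_mulrn !mul0rn; congr (gdiff _ _); apply: val_inj.
    by rewrite !val_pmonMn e1 aE -[LHS]mulr_natr divfK.
  rewrite -[in LHS](divfK n0 r) -tens_mulrn e_an tens_mulrn aE.
  by rewrite [r / _ * _]mulrAC -[r * _ / _]mulrA.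
rewrite /gval mulrBr tensBl -(tens_pos (repr x).1) -(tens_pos (repr x).2).
rewrite -tensNr -tensDr gdiffN gdiffD addr0 add0r gdiffE; exact: erefl.
Qed.

Lemma pmon_rank : has_rank M 1.
Proof.
have [e e1] := exists_pmon1; set g := gdiff e 0 : G.
have g1 : gval g = 1 by rewrite gval_gdiff e1 val_pmon0 subr0.
have fDl q r (x : G) : (q + r) * gval x = q * gval x + r * gval x.
  exact: mulrDl.
have fDr q (x y : G) : q * gval (x + y) = q * gval x + q * gval y.
  by rewrite gvalD mulrDr.
have [f [[fD fE] _]] := tens_univ fDl fDr.
have fg q : f (tens q g) = q by rewrite fE g1 mulr1.
(* Uniqueness in the universal property, applied to [tens] itself, identifies [tens (f t) g] with
   [t] by a check on pure tensors. *)
have [u [_ uniq]] := tens_univ (@tensDl G) (@tensDr G).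
have gf t : tens (f t) g = t.
  suff : (fun t => tens (f t) g) = id by move=> /(congr1 (@^~ t)).
  transitivity u; first symmetry.
    apply: uniq; split=> [s t'|q x]; first by rewrite fD tensDl.
    rewrite fE -(tens_gdiff q x e1); exact: erefl.
  apply: uniq; split=> [s t'|q x]; exact: erefl.
constructor; exists (fun t => const_mx (f t) : 'rV_1).
  move=> q s t; apply/rowP => i; rewrite !mxE fD.
  by rewrite -{1}(gf s) tensZ fg.
exists (fun v : 'rV_1 => tens (v 0 0) g) => [t|v]; first by rewrite mxE gf.
by apply/rowP => i; rewrite mxE fg ord1.
Qed.
End Rank.

(** * Leading terms in monoid algebras *)

Section MonoidAlgebraProducts.
Variables (R : idomainType) (M : nmodType).
Implicit Types f g : monoid_algebra R M.

Lemma ma_mcoeffM f g c :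
  (f * g)@_c = \sum_(a <- msupp f) \sum_(b <- msupp g)
                  (f@_a * g@_b) *+ (a + b == c).
Proof.
rewrite [f * g]/(ma_mul f g) /ma_mul raddf_sum; apply: eq_bigr => a _.
by rewrite raddf_sum; apply: eq_bigr => b _; exact: mcoeffU.
Qed.

Lemma ma_msuppM f g c : c \in msupp (f * g) ->
  exists a b, [/\ a \in msupp f, b \in msupp g & c = a + b].
Proof.
rewrite -mcoeff_neq0; apply: contra_neqP => no; rewrite ma_mcoeffM.
apply: big1_seq => a /= ha; apply: big1_seq => b /= hb.
by have [e|] := eqVneq (a + b) c; [case: no; exists a, b|rewrite mulr0n].
Qed.

(* Where the key [k] is additive and injective, its maximisers in the two
   supports contribute the only term at their sum. *)
Lemma ma_leading_term (k : M -> rat) f g : f != 0 -> g != 0 ->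
    {in msupp f &, injective k} -> {in msupp g &, injective k} ->
    {in msupp f & msupp g, forall a b, k (a + b) = k a + k b} ->
  exists a b, [/\ a \in msupp f, b \in msupp g, a + b \in msupp (f * g),
    {in msupp f, forall c, k c <= k a} & {in msupp g, forall c, k c <= k b}].
Proof.
move=> f0 g0 injf injg kD.
have max (h : monoid_algebra R M) : h != 0 -> exists2 a, a \in msupp h &
    forall c, c \in msupp h -> k c <= k a.
  move=> h0; apply: seq_argmax; apply: contraNneq h0 => e.
  apply/eqP/malgP => i.
  by rewrite mcoeff0 mcoeff_outdom //; have /negbT := in_nil i; rewrite -e.
have [[a af maxa] [b bg maxb]] := (max f f0, max g g0).
exists a, b; split=> //; rewrite -mcoeff_neq0 ma_mcoeffM.
rewrite (bigD1_seq a) ?fset_uniq //= (bigD1_seq b) ?fset_uniq //= eqxx mulr1n.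
(* Maximality makes the keys agree separately, and injectivity then leaves a single pair with sum
   [a + b]. *)
have uniq a' b' : a' \in msupp f -> b' \in msupp g -> a' + b' = a + b ->
    a' = a /\ b' = b.
  move=> ha hb e; have := kD _ _ ha hb; rewrite e kD // => eq_k.
  have := maxa _ ha; have := maxb _ hb => leb lea.
  by split; [apply: injf|apply: injg] => //; lra.
rewrite big_seq_cond big1 ?addr0 => [|b' /andP[hb' neq]]; last first.
  case: eqP => [/(uniq _ _ af hb')[_ /eqP]|]; last by rewrite mulr0n.
  by rewrite (negPf neq).
rewrite big_seq_cond big1 ?addr0 => [|a' /andP[ha' neq]]; last first.
  apply: big1_seq => b' /= hb'.
  case: eqP => [/(uniq _ _ ha' hb')[/eqP]|]; last by rewrite mulr0n.
  by rewrite (negPf neq).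
by rewrite mulf_neq0 // mcoeff_neq0.
Qed.

Lemma ma_exprU (c : R) (a : M) n :
  (<< c *g a >> : monoid_algebra R M) ^+ n = << c ^+ n *g a *+ n >>.
Proof.
elim: n => [|n IHn]; first by rewrite !expr0 mulr0n.
by rewrite !exprS mulrS IHn; exact: ma_mulUU.
Qed.

End MonoidAlgebraProducts.

(** * Frobenius and p-th roots *)

Section FrobeniusRoot.
Variables (p : nat) (M : nmodType).
Hypothesis p_pr : prime p.
Local Notation A := (monoid_algebra 'F_p M).

Lemma pchar_ma : p \in [pchar A].
Proof.
apply/andP; split=> //; apply/eqP.
change ((<< 1 *g 0 >> : {malg 'F_p[M]}) *+ p = 0).
by rewrite -monalgUMn pchar_Fp_0 // monalgU0.
Qed.

Lemma Fp_expr (c : 'F_p) : c ^+ p = c.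
Proof.
by rewrite -[c]natr_Zp -(pFrobenius_autE (pchar_Fp p_pr)) pFrobenius_aut_nat.
Qed.

(** The p-th power map is additive in characteristic p and fixes coefficients by Fermat's little
    theorem, so dividing the exponents by p gives a root. *)
Lemma ma_pth_root (g : A) :
  (forall a, a \in msupp g -> exists b, b *+ p = a) -> exists h : A, g = h ^+ p.
Proof.
move=> div.
have /choice[r hr] a : exists b, a \in msupp g -> b *+ p = a.
  have [/div[b]|_] := boolP (a \in msupp g); first by exists b.
  by exists 0.
exists (\sum_(a <- msupp g) << g@_a *g r a >>).
have D (x y : A) : (x + y) ^+ p = x ^+ p + y ^+ p.
  rewrite -!(pFrobenius_autE pchar_ma); apply: pFrobenius_autD_comm.
  exact: mulrC.
have Z : (0 : A) ^+ p = 0 by rewrite expr0n eqn0Ngt prime_gt0.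
rewrite [LHS]monalgE (big_morph (fun x : A => x ^+ p) D Z).
rewrite big_seq [RHS]big_seq; apply: eq_bigr => a ha.
by rewrite ma_exprU Fp_expr hr.
Qed.

End FrobeniusRoot.

(** * Factors of 1 + x *)

Section NotAtomic.
Variable p : nat.
Hypothesis p_pr : prime p.
Local Notation M := (pmon p).
Local Notation A := (monoid_algebra 'F_p M).
Implicit Types (s t : M) (g h : A).

Lemma digit_eq0P s : (forall n, digit s n = 0) <-> padic p (val s).
Proof.
split=> [d0|hs n].
  have [hu _ _ ->] := is_rep_pmon s.
  by rewrite big1 ?addr0 // => n _; rewrite d0 cost0.
have [] // := rep_digit p_pr (s := s) (u := val s) (w := fun=> 0) (N := 0).
by split=> //; rewrite big_ord0 addr0.
Qed.

Variable e : M.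
Hypothesis e1 : val e = 1.

Definition one_plus_x : A := (1 : A) + (<< (1 : 'F_p) *g e >> : {malg 'F_p[M]}).

Lemma digit0 n : digit (0 : M) n = 0.
Proof. by apply: (digit_eq0P _).2; rewrite val_pmon0; exact: padic0. Qed.

Lemma digite n : digit e n = 0.
Proof. by apply: (digit_eq0P _).2; rewrite e1; exact: padic_nat 1. Qed.

Lemma e_neq0 : (e == 0) = false.
Proof. by apply/eqP => e0; move: e1; rewrite e0 val_pmon0. Qed.

Lemma mcoeff_one_plus_x c : one_plus_x@_c = (0 == c)%:R + (e == c)%:R.
Proof. by rewrite [LHS]mcoeffD !mcoeffU. Qed.

Lemma msupp_one_plus_x c : (c \in msupp one_plus_x) = (c == 0) || (c == e).
Proof.
rewrite -mcoeff_neq0 mcoeff_one_plus_x !(eq_sym _ c).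
have [->|_] := eqVneq c 0; first by rewrite [0 == e]eq_sym e_neq0 addr0 oner_neq0.
by rewrite mulr0n add0r; case: (c == e); rewrite ?mulr1n ?mulr0n ?oner_neq0 ?eqxx.
Qed.

Lemma one_plus_x_neq0 : one_plus_x != 0.
Proof.
apply/eqP => F0; have := msupp_one_plus_x 0.
by rewrite eqxx F0 -mcoeff_neq0 mcoeff0 eqxx.
Qed.

Lemma one_plus_x_factor_neq0 g h : g * h = one_plus_x -> g != 0 /\ h != 0.
Proof.
by move=> gh; split; apply: contraNneq one_plus_x_neq0 => z;
   rewrite -gh z ?mul0r ?mulr0.
Qed.

(** With [val] as key, the leading exponents of the factors sum to an exponent of 1 + x, hence to
    value at most 1. The exponent 0 arises only as 0 + 0. *)
Lemma one_plus_x_factor_val g h : g * h = one_plus_x ->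
  [/\ 0 \in msupp g, 0 \in msupp h &
      {in msupp g & msupp h, forall s t, val s + val t <= 1}].
Proof.
move=> gh; have [g0 h0] := one_plus_x_factor_neq0 gh.
have [|a [b [ha hb ab]]] := @ma_msuppM _ _ g h 0.
  by rewrite gh msupp_one_plus_x eqxx.
have a0 : a = 0.
  apply: pmon_val_eq0; move/(congr1 val): ab; rewrite val_pmonD val_pmon0.
  by have := pmon_ge0 a; have := pmon_ge0 b; lra.
have b0 : b = 0 by rewrite ab a0 add0r.
split; [by rewrite -a0|by rewrite -b0|].
have inj (D : {pred M}) : {in D &, injective (val : M -> rat)}.
  by move=> ? ? _ _; exact: val_inj.
have [|c [d [_ _ cd maxc maxd]]] := ma_leading_term g0 h0 (inj _) (inj _).
  by move=> s t _ _; exact: val_pmonD.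
have le1 : val c + val d <= 1.
  rewrite -val_pmonD; move: cd; rewrite gh msupp_one_plus_x => /orP[]/eqP->.
    by rewrite val_pmon0.
  by rewrite e1.
by move=> s t /maxc + /maxd; lra.
Qed.

(* On pairs with val s + val t <= 1 the key 2 * eps * digit s n + val s is
   additive, and it is injective as val s lies in [0, 1]; its maximum over a
   factor is at most its value at the two elements of the support of 1 + x. *)
Lemma one_plus_x_factor_digit g h s n : g * h = one_plus_x -> s \in msupp g ->
  digit s n = 0.
Proof.
move=> gh sg; have [g0 h0] := one_plus_x_factor_neq0 gh.
have [zg zh le1] := one_plus_x_factor_val gh.
have main (eps : int) : `|eps| = 1 -> eps * digit s n <= 0.
  move=> eps1.
  pose k (t : M) : rat := (2 * (eps * digit t n))%:~R + val t.
  have inj (t t' : M) : val t <= 1 -> val t' <= 1 -> k t = k t' -> t = t'.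
    rewrite /k => ht ht' kk.
    have z : (2 * (eps * digit t n) - 2 * (eps * digit t' n))%:~R =
       val t' - val t by rewrite intrB; lra.
    have : (2 * (eps * digit t n) - 2 * (eps * digit t' n))%:~R <= 1%:~R :> rat.
      by rewrite z; have := pmon_ge0 t; have := pmon_ge0 t'; lra.
    have : (- 1)%:~R <= (2 * (eps * digit t n) - 2 * (eps * digit t' n))%:~R :> rat.
      by rewrite z; have := pmon_ge0 t; have := pmon_ge0 t'; lra.
    rewrite !ler_int => l1 l2.
    (* An even integer between -1 and 1 is 0. *)
    have dd : eps * digit t n = eps * digit t' n by lia.
    by apply: val_inj; move: z; rewrite dd subrr; lra.
  have kD : {in msupp g & msupp h, forall t t', k (t + t') = k t + k t'}.
    move=> t t' ht ht'; rewrite /k digitD ?le1 // val_pmonD mulrDr mulrDr intrD.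
    by ring.
  have k0 : k 0 = 0 by rewrite /k digit0 !mulr0 val_pmon0 addr0.
  have [|| a [b [ha hb ab maxa maxb]]] := @ma_leading_term _ _ k g h g0 h0 _ _ kD.
  - move=> t t' ht ht'; apply: inj.
      by have := le1 _ _ ht zh; rewrite val_pmon0 addr0.
    by have := le1 _ _ ht' zh; rewrite val_pmon0 addr0.
  - move=> t t' ht ht'; apply: inj.
      by have := le1 _ _ zg ht; rewrite val_pmon0 add0r.
    by have := le1 _ _ zg ht'; rewrite val_pmon0 add0r.
  have := maxa _ sg; have := maxb _ zh.
  have kab : k a + k b <= 1.
    rewrite -kD //; move: ab; rewrite gh msupp_one_plus_x => /orP[]/eqP->.
      by rewrite k0.
    by rewrite /k digite !mulr0 add0r e1.
  rewrite k0 => kb; rewrite {1}/k => ka; have := pmon_ge0 s => s0.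
  (* From [k b >= k 0 = 0] follows [k s <= k a <= 1]; an even integer at most 1 is at most 0. *)
  have : (2 * (eps * digit s n))%:~R <= 1%:~R :> rat by lra.
  rewrite ler_int => le; clear -le; lia.
have := main 1 erefl; have := main (-1) erefl; clear; lia.
Qed.

(** The leading exponent of a multiple of 1 + x has value at least 1, whereas 1 is supported at
    0. *)
Lemma one_plus_x_not_unit : ~ is_unit (@GRing.mul A) 1 (predC1 0) one_plus_x.
Proof.
move=> [_ [v v0 Fv]].
have inj (D : {pred M}) : {in D &, injective (val : M -> rat)}.
  by move=> ? ? _ _; exact: val_inj.
have [|a [b [_ _ ab maxa _]]] := ma_leading_term one_plus_x_neq0 v0 (inj _) (inj _).
  by move=> s t _ _; exact: val_pmonD.
have ea : val e <= val a by apply: maxa; rewrite msupp_one_plus_x eqxx orbT.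
move: ab; rewrite Fv -mcoeff_neq0 [1]/(ma_one _ _) mcoeffU.
case: (0 =P a + b) => [/(congr1 val)|_]; last by rewrite eqxx.
rewrite val_pmonD val_pmon0 => ab _.
by move: ea; rewrite e1; have := pmon_ge0 b; lra.
Qed.

(** The first atom [g] of a factorization of 1 + x is a p-th power, so [g = q * q ^+ p.-1]; if
    either factor were a unit, so would be [g]. *)
Lemma ma_not_atomic : ~ atomic_domain A.
Proof.
move=> /(_ one_plus_x one_plus_x_neq0 one_plus_x_not_unit)[[|g l] atoms /= FE].
  apply: one_plus_x_not_unit; split; first exact: one_plus_x_neq0.
  by exists 1; rewrite ?FE ?mulr1 // inE oner_neq0.
have [g0 gnu gat] := atoms g (mem_head _ _).
have [q gq] : exists q : A, g = q ^+ p.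
  apply: ma_pth_root => // s sg.
  have /digit_eq0P[ps [j [m hm]]] : forall n, digit s n = 0.
    by move=> n; apply: one_plus_x_factor_digit (esym FE) sg.
  have p0 : p%:R != 0 :> rat by rewrite pnatr_eq0 -lt0n prime_gt0.
  have [|t [tv _ _]] := @padic_pmon p p_pr (val s / p%:R).
    split; first by rewrite divr_ge0.
    by exists j.+1, m; rewrite expnS natrM mulrA divfK.
  by exists t; apply: val_inj; rewrite val_pmonMn tv -[LHS]mulr_natr divfK.
(* As [p >= 2], [q] divides [q ^+ p.-1], so an inverse of the latter yields one of [q]. *)
have p1 : p.-1 = p.-2.+1 by have := prime_gt1 p_pr; lia.
have q_not_unit (v : A) : q * v <> 1.
  move=> qv; have gv : g * v ^+ p = 1 by rewrite gq -exprMn qv expr1n.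
  apply: gnu; split=> //; exists (v ^+ p) => //; rewrite inE.
  by apply: contra_eq_neq gv => ->; rewrite mulr0 eq_sym oner_neq0.
have gqq : g = q * q ^+ p.-1 by rewrite gq -exprS prednK ?prime_gt0.
have q0 : q != 0 by apply: contraNneq g0 => z; rewrite gqq z mul0r.
have r0 : q ^+ p.-1 != 0 by apply: contraNneq g0 => z; rewrite gqq z mulr0.
move: (gat q (q ^+ p.-1)); rewrite !inE q0 r0 => /(_ isT isT gqq).
case=> [[_ [v _ qv]]|[_ [v _ qv]]].
  exact: (q_not_unit v qv).
apply: (q_not_unit (q ^+ p.-2 * v)).
by rewrite mulrA -exprS -p1; exact: qv.
Qed.

End NotAtomic.

Theorem theorem3p12 (p : nat) (hp : prime p) :
  exists M : nmodType,
    [/\ cancellative M, torsion_free M, has_rank M 1, MCD_monoid M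
      & atomic_monoid M]
    /\ ~ atomic_domain (monoid_algebra 'F_p M).
Proof.
exists (pmon p); have [e e1] := exists_pmon1 hp.
split; last exact (ma_not_atomic hp e1).
split; [exact: pmon_cancellative|exact: pmon_torsion_free|exact: pmon_rank
       |exact: pmon_MCD|exact: pmon_atomic].
Qed.
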